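(* Let $n\in\mathbb{N}$ and $x=12n+4$. Then the degree of $x$ in the near Goldbach graph $G(x/2)$ is $n-f(n)+1$ if $x-3$ is prime, and $n-f(n)$ if $x-3$ is not prime, where $$f(n)=\left|\bigcup_{\substack{p \text{ prime}\\ 3<p<\sqrt{x}}}\left(F(x,p,+)\cup F(x,p,-)\right)\right|.$$
   Context: $\mathbb{N}$ denotes the positive integers. For $N\in\mathbb{N}$, the near Goldbach graph $G(N)$ is the simple undirected graph with vertex set $\{2,4,\ldots,2N\}$ in which two distinct vertices $a,b$ are adjacent iff both $\frac{a+b}{2}$ and $\frac{|a-b|}{2}$ lie in $\{q: q\text{ prime},\ 2<q<2N\}\cup\{1\}$. For $x=12n+4$ let $S(n)=\{12m+6 : m\in\mathbb{N}\cup\{0\},\ m<n\}$. For a prime $p$ with $3<p<\sqrt{x}$, $F(x,p,+)=\{y\in S(n): p\mid x+y\}$ and $F(x,p,-)=\{y\in S(n): p\mid x-y,\ x-y\neq 2p\}$. *)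

(* Defs.v *)
From HB Require Import structures.
From mathcomp Require Import all_boot all_order all_algebra all_field.
From mathcomp Require Import finmap.

Set Implicit Arguments.
Unset Strict Implicit.
Unset Printing Implicit Defensive.

Import Order.TTheory GRing.Theory Num.Theory.

Local Open Scope nat_scope.
Local Open Scope fset_scope.

Definition ng_vertices (N : nat) : {fset nat} :=
  [fset (2 * i)%N | i in iota 1 N].

Definition ng_admissible (N q : nat) : bool :=
  [&& prime q, 2 < q & q < 2 * N] || (q == 1).

(* Both quotients are exact, since vertices are even; `|a - b| is the
   (untruncated) distance between naturals. *)
Definition ng_adj (N : nat) : rel nat := fun a b =>
  [&& a \in ng_vertices N, b \in ng_vertices N, a != b,
      ng_admissible N ((a + b) %/ 2)
    & ng_admissible N (`|a - b|%N %/ 2)].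

Lemma ng_adj_irr (N : nat) : irreflexive (ng_adj N).
Proof. by move=> a; rewrite /ng_adj eqxx !andbF. Qed.

Lemma ng_adj_sym (N : nat) : symmetric (ng_adj N).
Proof.
by move=> a b; rewrite /ng_adj addnC distnC eq_sym; apply: andbCA.
Qed.

Definition ng_degree (N a : nat) : nat :=
  #|` [fset b in ng_vertices N | ng_adj N a b] |.

Definition ngS (n : nat) : {fset nat} := [fset (12 * m + 6)%N | m in iota 0 n].

Definition ngx (n : nat) : nat := 12 * n + 4.

Definition ngF_plus (n p : nat) : {fset nat} :=
  [fset y in ngS n | p %| ngx n + y].

(* Truncated subtraction is harmless: y < ngx n for all y in ngS n. *)
Definition ngF_minus (n p : nat) : {fset nat} :=
  [fset y in ngS n | (p %| ngx n - y) && (ngx n - y != 2 * p)].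

(* The index bound p < ngx n only makes the union finite: it is implied by
   p < sqrt (ngx n), as ngx n >= 1. *)
Definition ngf (n : nat) : nat :=
  #|` \bigcup_(p <- iota 0 (ngx n) |
         [&& prime p, 3 < p & (p%:R < sqrtC (ngx n)%:R :> algC)%R])
        (ngF_plus n p `|` ngF_minus n p) |.

(* Main.v *)
Require Import Defs.
From mathcomp Require Import all_boot all_order all_algebra.
From mathcomp Require Import all_field finmap zify.

(** A neighbour [b < x] of [x] in [G(x/2)] is a way of writing [x] as an
    ordered sum [(x + b)/2 + (x - b)/2] of two admissible numbers.  Everything
    follows from reducing [x = 12 n + 4] modulo 12.

    Modulo 3 we have [x = 1], so either one of the two parts is divisible by 3,
    or both are 2 modulo 3.  The larger part is neither 3 nor (when the smaller
    one is 1) the multiple of three [x - 1], so in the first case the smaller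
    part is 3 and [b = x - 6], which is a neighbour exactly when [x - 3] is
    prime.  In the second case 3 divides [b]; as the two parts are odd with a
    sum divisible by 4, their difference [b] is 2 modulo 4, so [b] lies in the
    set [S(n)] of the residue class of 6 modulo 12.  This is
    [ng_adj_apex].

    Conversely, for [y] in [S(n)] both parts are 5 modulo 6, hence coprime to 6,
    and they are less than [x].  Such a number is composite exactly when it has
    a prime divisor [p] other than itself with [3 < p] and [p ^ 2 < x]
    ([not_primeP]).  This is what the sets [F(x, p, +)] and [F(x, p, -)] detect:
    the exclusion of [x - y = 2 p] keeps the case in which the smaller part is
    the small prime [p] itself, while the larger part is at least [x / 2],
    too large to be such a [p].  So the union [U] of these sets consists of the
    elements of [S(n)] that are not neighbours ([mem_sifted]), and the
    neighbourhood of [x] is [S(n) \ U], together with [x - 6] when [x - 3] is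
    prime. *)

Import Order.TTheory GRing.Theory Num.Theory.

Local Open Scope nat_scope.

Definition sifted (n : nat) : {fset nat} :=
  (\bigcup_(p <- iota 0 (ngx n) |
      [&& prime p, 3 < p & (p%:R < sqrtC (ngx n)%:R :> algC)%R])
     (ngF_plus n p `|` ngF_minus n p))%fset.

Lemma ltn_sqrtC (p x : nat) :
  (p%:R < sqrtC x%:R :> algC)%R = (p ^ 2 < x).
Proof.
rewrite -(@ltr_pXn2r _ 2) ?sqrtCK //.
- by rewrite -natrX ltr_nat.
- by rewrite nnegrE ler0n.
- by rewrite nnegrE sqrtC_ge0 ler0n.
Qed.

(** Trial division: a composite [v] has a prime divisor [p] with
    [p ^ 2 <= v < x], and coprimality with 6 forces [3 < p].  The condition
    [p != v] matters because [v] may itself be a prime below the square root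
    of [x]. *)
Lemma not_primeP {x v : nat} : 1 < v < x -> coprime 6 v ->
  reflect (exists p, [/\ prime p, 3 < p, p ^ 2 < x, p %| v & p != v])
          (~~ prime v).
Proof.
move=> /andP[v_gt1 v_lt_x] co6v.
apply: (iffP primePns) => [[|[p [p_pr le_p2v p_v]]]|[p [p_pr _ _ p_v p_neq]]].
- by lia.
- exists p; split=> //.
  + have: ~~ (p %| 6).
      by apply: contraTN co6v => p_6; apply: contraL p_pr => /eqP co;
         have := dvdn_gcd p 6 v; rewrite p_6 p_v co dvdn1 => /eqP ->.
    by have := prime_gt1 p_pr; case: p {p_pr le_p2v p_v} => [|[|[|[|p]]]].
  + exact: leq_ltn_trans v_lt_x.
  + apply: contraTneq le_p2v => ->; rewrite -ltnNge.
    by rewrite -[ltnLHS]muln1 ltn_pmul2l // ltnW.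
- have : ~~ prime v by apply: contraNN p_neq => v_pr; rewrite -dvdn_prime2.
  by move/primePns.
Qed.

Lemma ngSP {n y : nat} :
  reflect (exists2 m, m < n & y = 12 * m + 6) (y \in ngS n).
Proof.
apply: (iffP (imfsetP _ _ _ _)) => -[m /= lt_m ->]; exists m => //.
  by move: lt_m; rewrite mem_iota.
by rewrite /= mem_iota.
Qed.

Lemma card_ngS (n : nat) : #|` ngS n| = n.
Proof.
rewrite card_imfset /= ?undup_id ?iota_uniq ?size_iota // => i j /=; lia.
Qed.

Lemma sifted_sub (n : nat) : (sifted n `<=` ngS n)%fset.
Proof.
apply/fsubsetP=> y /bigfcupP[p _].
by rewrite !inE => /orP[] /andP[].
Qed.

(** The larger half [(x + y)/2] cannot be a prime below [sqrt x], so the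
    condition [p != v] of [not_primeP] is automatic for it; for the smaller
    half it is the condition [x - y != 2 * p] of the definition. *)
Lemma mem_sifted (n y : nat) : y \in ngS n ->
  (y \in sifted n) =
  ~~ (prime ((ngx n + y) %/ 2) && prime ((ngx n - y) %/ 2)).
Proof.
move=> yS; have [m lt_mn def_y] := ngSP yS.
set u := (ngx n + y) %/ 2; set v := (ngx n - y) %/ 2.
have def_u : ngx n + y = 2 * u by rewrite /u /ngx def_y; lia.
have def_v : ngx n - y = 2 * v by rewrite /v /ngx def_y; lia.
have u5 : u = 6 * (n + m) + 5 by move: def_u; rewrite /ngx; lia.
have v5 : v = 6 * (n - m.+1) + 5 by move: def_v; rewrite /ngx; lia.
have u_bounds : 1 < u < ngx n by rewrite u5 /ngx; lia.
have v_bounds : 1 < v < ngx n by rewrite v5 /ngx; lia.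
have co6u : coprime 6 u by rewrite u5 mulnC /coprime gcdnMDl.
have co6v : coprime 6 v by rewrite v5 mulnC /coprime gcdnMDl.
have uP := not_primeP u_bounds co6u; have vP := not_primeP v_bounds co6v.
have dvd_half p k : prime p -> 3 < p -> (p %| 2 * k) = (p %| k).
  move=> p_pr p_gt3; rewrite Gauss_dvdr // prime_coprime //.
  by apply: contraTN p_gt3 => /dvdn_leq; lia.
rewrite negb_and; apply/bigfcupP/orP.
- case=> p /andP[_ /and3P[p_pr p_gt3]]; rewrite ltn_sqrtC => p_lt.
  rewrite !inE /= yS /= def_u def_v !dvd_half // eqn_pmul2l //.
  case/orP=> [p_u | /andP[p_v p_neq]]; [left; apply/uP | right; apply/vP].
  + exists p; split=> //; apply: contraTneq p_lt => ->; rewrite -leqNgt.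
    by move: def_u; rewrite u5 /ngx; nia.
  + by exists p; split=> //; rewrite eq_sym.
- have mem_p p : prime p -> 3 < p -> p ^ 2 < ngx n ->
      (p \in iota 0 (ngx n)) &&
      [&& prime p, 3 < p & (p%:R < sqrtC (ngx n)%:R :> algC)%R].
    by move=> p_pr p_gt3 p_lt; rewrite ltn_sqrtC p_pr p_gt3 p_lt mem_iota; nia.
  case=> [/uP|/vP] [p [p_pr p_gt3 p_lt p_dvd p_neq]]; exists p;
    rewrite ?mem_p // !inE /= yS /= def_u def_v !dvd_half // eqn_pmul2l //.
    by rewrite p_dvd.
  by rewrite p_dvd eq_sym p_neq orbT.
Qed.

Lemma ng_verticesP (N b : nat) :
  (b \in ng_vertices N) = [&& ~~ odd b, 0 < b & b <= 2 * N].
Proof.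
apply/(imfsetP _ _ _ _)/idP => [[i /= i_in ->]|b_in].
  by move: i_in; rewrite mem_iota; lia.
by exists b./2; rewrite /= ?mem_iota; lia.
Qed.

Lemma prime_mod3 {p : nat} : prime p -> p != 3 -> p %% 3 != 0.
Proof. by move=> p_pr; rewrite -[_ == 0]/(3 %| p) dvdn_prime2 // eq_sym. Qed.

(** With [u] and [v] the two halves, [u + v] is 1 modulo 3 and a prime other
    than 3 is nonzero modulo 3, so [v = 3] (the first alternative) or both
    halves are 2 modulo 3.  In the latter case they are also odd with a sum
    divisible by 4, which gives [u - v] the residue 6 modulo 12. *)
Lemma ng_adj_apex (n b : nat) : 0 < n ->
  ng_adj (6 * n + 2) (ngx n) b =
  (b == 12 * n - 2) && prime (12 * n + 1) ||
  (b \in ngS n) && (prime ((ngx n + b) %/ 2) && prime ((ngx n - b) %/ 2)).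
Proof.
move=> n_gt0; rewrite /ng_adj !ng_verticesP /ng_admissible.
have [b_ge | b_lt] := leqP (ngx n) b.
  apply/idP/idP => [/and5P[_ /and3P[_ _ b_le] b_neq _ _] | ].
    by case/negP: b_neq; apply/eqP; move: b_ge b_le; rewrite /ngx; lia.
  case/orP=> [/andP[/eqP def_b _] | /andP[/ngSP[m lt_mn def_b] _]];
    by move: b_ge; rewrite def_b /ngx; lia.
have -> : `|ngx n - b|%N = ngx n - b by lia.
set u := (ngx n + b) %/ 2; set v := (ngx n - b) %/ 2.
apply/idP/idP => [/and5P[_ /and3P[b_even b_gt0 _] _ adm_u adm_v] | ].
- have def_u : ngx n + b = 2 * u by rewrite /u /ngx; lia.
  have def_v : ngx n - b = 2 * v by rewrite /v /ngx; lia.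
  have x_uv : u + v = 12 * n + 4 by move: def_u def_v b_lt; rewrite /ngx; lia.
  have b_uv : u = b + v by lia.
  (* Since u >= x / 2 >= 8, neither u = 1 nor u = 3 is possible. *)
  have [u_pr u_mod3] : prime u /\ u %% 3 != 0.
    case/orP: adm_u => [/and3P[u_pr _ _] | /eqP u1]; last by lia.
    by split=> //; apply: prime_mod3 => //; apply/eqP; lia.
  (* If v = 1 then u = 12 n + 3 is a multiple of 3. *)
  case/orP: adm_v => [/and3P[v_pr v_gt2 _] | /eqP v1]; last by lia.
  have [v3 | v_neq3] := eqVneq v 3.
    have -> : 12 * n + 1 = u by lia.
    by rewrite u_pr andbT; apply/orP; left; apply/eqP; lia.
  have v_mod3 := prime_mod3 v_pr v_neq3.
  have u_odd : odd u by case: (even_prime u_pr) => // u2; lia.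
  have v_odd : odd v by case: (even_prime v_pr) => // v2; lia.
  rewrite u_pr v_pr !andbT; apply/orP; right; apply/ngSP.
  by exists (b %/ 12); lia.
- case/orP=> [/andP[/eqP def_b x3_pr] | /andP[/ngSP[m lt_mn def_b]]].
    have -> : u = 12 * n + 1 by rewrite /u def_b /ngx; lia.
    have -> : v = 3 by rewrite /v def_b /ngx; lia.
    by rewrite x3_pr def_b /ngx /=; lia.
  case/andP=> u_pr v_pr; rewrite u_pr v_pr.
  have u5 : u = 6 * (n + m) + 5 by rewrite /u def_b /ngx; lia.
  have v5 : v = 6 * (n - m.+1) + 5 by rewrite /v def_b /ngx; lia.
  by rewrite u5 v5 def_b /ngx; lia.
Qed.

Lemma neighbours_apex (n : nat) : 0 < n ->
  ([fset b in ng_vertices (6 * n + 2) | ng_adj (6 * n + 2) (ngx n) b] =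
   (if prime (12 * n + 1) then [fset (12 * n - 2)%N] else fset0) `|`
   (ngS n `\` sifted n))%fset.
Proof.
move=> n_gt0; apply/fsetP=> b; rewrite !inE /=.
have -> : (b \in ng_vertices (6 * n + 2)) && ng_adj (6 * n + 2) (ngx n) b =
          ng_adj (6 * n + 2) (ngx n) b.
  by apply/andb_idl => /and5P[].
rewrite ng_adj_apex //; congr (_ || _).
  by case: ifP => _; rewrite !inE ?andbT ?andbF.
have [b_S | _] := boolP (b \in ngS n); last by rewrite andbF.
by rewrite mem_sifted // negbK andbT.
Qed.

(** The vertex [x - 6] is 10 modulo 12, so it lies outside [S(n)] and the two
    parts of the neighbourhood are disjoint.  The sum form of the equation
    avoids truncated subtraction. *)
Lemma degree_apex (n : nat) : 0 < n ->
  ng_degree (6 * n + 2) (ngx n) + ngf n = n + prime (12 * n + 1).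
Proof.
move=> n_gt0; rewrite /ng_degree neighbours_apex //.
have apexNS : 12 * n - 2 \notin ngS n by apply/ngSP=> -[m]; lia.
have cardSU : #|` (ngS n `\` sifted n)%fset| + ngf n = n.
  rewrite -[RHS](card_ngS n) cardfsDS ?sifted_sub // subnK //.
  exact/fsubset_leq_card/sifted_sub.
case: (prime _); last by rewrite fset0U cardSU addn0.
by rewrite cardfsU1 !inE negb_and apexNS orbT -addnA cardSU addnC.
Qed.

Theorem theorem2p3 (n x : nat) (hn : (0 < n)%N) (hx : x = (12 * n + 4)%N) :
  (prime (x - 3) -> ((ng_degree (x %/ 2) x)%:Z = n%:Z - (ngf n)%:Z + 1)%R) /\
  (~~ prime (x - 3) -> ((ng_degree (x %/ 2) x)%:Z = n%:Z - (ngf n)%:Z)%R).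
Proof.
have -> : x - 3 = 12 * n + 1 by lia.
have -> : x %/ 2 = 6 * n + 2 by lia.
have -> : x = ngx n by rewrite hx.
by split=> [|/negbTE] x3_pr; move: (degree_apex n hn); rewrite x3_pr; lia.
Qed.
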